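(* Let $A,B$ be rings, $(\mathfrak{C},\Delta_{\mathfrak{C}},\varepsilon_{\mathfrak{C}})$ an $A$-coring and $(\mathfrak{D},\Delta_{\mathfrak{D}},\varepsilon_{\mathfrak{D}})$ a $B$-coring. Let $\mathcal{M}:\mathscr{M}^{\mathfrak{C}}\to\mathscr{M}^{\mathfrak{D}}$ and $\mathcal{N}:\mathscr{M}^{\mathfrak{D}}\to\mathscr{M}^{\mathfrak{C}}$ be additive covariant functors preserving cokernels and direct sums, and let $\widetilde{\eta}:\mathcal{N}\mathcal{M}\to\mathrm{id}_{\mathscr{M}^{\mathfrak{C}}}$ and $\widetilde{\rho}:\mathcal{M}\mathcal{N}\to\mathrm{id}_{\mathscr{M}^{\mathfrak{D}}}$ be natural transformations such that $\widetilde{\eta}_{\mathcal{N}(Y)}=\mathcal{N}\widetilde{\rho}_Y$ for every $Y\in\mathscr{M}^{\mathfrak{D}}$ and $\widetilde{\rho}_{\mathcal{M}(X)}=\mathcal{M}\widetilde{\eta}_X$ for every $X\in\mathscr{M}^{\mathfrak{C}}$. Assume that there are an $(A,\mathfrak{D})$-bicomodule $(M,\varrho^M)$ and a $(B,\mathfrak{C})$-bicomodule $(N,\varrho^N)$ such that $\mathcal{M}=(-\otimes_AM)\circ\mathcal{O}_{\mathfrak{C}}$ and $\mathcal{N}=(-\otimes_BN)\circ\mathcal{O}_{\mathfrak{D}}$, where $\mathcal{O}_{\mathfrak{C}}:\mathscr{M}^{\mathfrak{C}}\to\mathscr{M}_A$ and $\mathcal{O}_{\mathfrak{D}}:\mathscr{M}^{\mathfrak{D}}\to\mathscr{M}_B$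 are the forgetful functors and $-\otimes_AM:\mathscr{M}_A\to\mathscr{M}^{\mathfrak{D}}$, $-\otimes_BN:\mathscr{M}_B\to\mathscr{M}^{\mathfrak{C}}$ are the functors with coactions $X\otimes_A\varrho^M$ and $Y\otimes_B\varrho^N$. Put $$\mathfrak{m}:\mathfrak{C}\otimes_AM\xrightarrow{\ \mathfrak{C}\otimes\varrho^M\ }\mathfrak{C}\otimes_AM\otimes_B\mathfrak{D}\xrightarrow{\ \varepsilon_{\mathfrak{C}}\otimes M\otimes\mathfrak{D}\ }A\otimes_AM\otimes_B\mathfrak{D}\cong M\otimes_B\mathfrak{D},$$ $$\mathfrak{n}:\mathfrak{D}\otimes_BN\xrightarrow{\ \mathfrak{D}\otimes\varrho^N\ }\mathfrak{D}\otimes_BN\otimes_A\mathfrak{C}\xrightarrow{\ \varepsilon_{\mathfrak{D}}\otimes N\otimes\mathfrak{C}\ }B\otimes_BN\otimes_A\mathfrak{C}\cong N\otimes_A\mathfrak{C}.$$ Then $\Gamma=((M,\mathfrak{m}),(N,\mathfrak{n}),\eta,\rho)$ is a $1$-cell from $(\mathfrak{D}:B)$ to $(\mathfrak{C}:A)$ in $\mathsf{W(REM(Bim))}$, where $\eta=\varepsilon_{\mathfrak{C}}\circ\widetilde{\eta}_{\mathfrak{C}}:\mathfrak{C}\otimes_AM\otimes_BN\to A$ and $\rho=\varepsilon_{\mathfrak{D}}\circ\widetilde{\rho}_{\mathfrak{D}}:\mathfrak{D}\otimes_BN\otimes_AM\to B$.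
   Context: Rings are associative with $1$; modules and bimodules are unital; the identity map of a module $X$ is denoted $X$; $\mathscr{M}_A$ is the category of right $A$-modules. Corings and comodules. An $A$-coring is $(\mathfrak{C},\Delta,\varepsilon)$ with $\mathfrak{C}$ an $A$-bimodule and $A$-bilinear maps $\Delta:\mathfrak{C}\to\mathfrak{C}\otimes_A\mathfrak{C}$, $\varepsilon:\mathfrak{C}\to A$ with $(\mathfrak{C}\otimes_A\Delta)\circ\Delta=(\Delta\otimes_A\mathfrak{C})\circ\Delta$ and $(\mathfrak{C}\otimes_A\varepsilon)\circ\Delta=\mathfrak{C}=(\varepsilon\otimes_A\mathfrak{C})\circ\Delta$. A right $\mathfrak{C}$-comodule is $(X,\varrho^X)$ with $X$ a right $A$-module and $\varrho^X:X\to X\otimes_A\mathfrak{C}$ right $A$-linear with $(\varrho^X\otimes_A\mathfrak{C})\circ\varrho^X=(X\otimes_A\Delta)\circ\varrho^X$ and $(X\otimes_A\varepsilon)\circ\varrho^X=X$. A right $A$-linear map $f:X\to X'$ is right $\mathfrak{C}$-colinear if $\varrho^{X'}\circ f=(f\otimes_A\mathfrak{C})\circ\varrho^X$. $\mathscr{M}^{\mathfrak{C}}$ is the category of right $\mathfrak{C}$-comodules and colinear maps; it has cokernels and direct sums, computed in $\mathscr{M}_A$. $\mathfrak{C}$ is a right $\mathfrak{C}$-comodule via $\Delta_{\mathfrak{C}}$. An $(A,\mathfrak{D})$-bicomodule (with $A$ regarded as the trivial $A$-coring) is a right $\mathfrak{D}$-comodule $(M,\varrho^M)$ whose underlying module is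 an $(A,B)$-bimodule and whose coaction is $A$-$B$-bilinear; similarly for $(B,\mathfrak{C})$-bicomodules. $1$-cells of $\mathsf{W(REM(Bim))}$. A $1$-cell from $(\mathfrak{D}:B)$ to $(\mathfrak{C}:A)$ is a four-tuple $((M,\mathfrak{m}),(N,\mathfrak{n}),\eta,\rho)$ where $M$ is an $(A,B)$-bimodule, $N$ is a $(B,A)$-bimodule, and $\mathfrak{m}:\mathfrak{C}\otimes_AM\to M\otimes_B\mathfrak{D}$, $\mathfrak{n}:\mathfrak{D}\otimes_BN\to N\otimes_A\mathfrak{C}$, $\eta:\mathfrak{C}\otimes_AM\otimes_BN\to A$, $\rho:\mathfrak{D}\otimes_BN\otimes_AM\to B$ are bilinear maps satisfying, up to the canonical isomorphisms $A\otimes_A-\cong-$, $-\otimes_AA\cong-$ (and likewise for $B$): $$(M\otimes_B\varepsilon_{\mathfrak{D}})\circ\mathfrak{m}=\varepsilon_{\mathfrak{C}}\otimes_AM,\quad(\mathfrak{m}\otimes_B\mathfrak{D})\circ(\mathfrak{C}\otimes_A\mathfrak{m})\circ(\Delta_{\mathfrak{C}}\otimes_AM)=(M\otimes_B\Delta_{\mathfrak{D}})\circ\mathfrak{m},$$ $$(N\otimes_A\varepsilon_{\mathfrak{C}})\circ\mathfrak{n}=\varepsilon_{\mathfrak{D}}\otimes_BN,\quad(\mathfrak{n}\otimes_A\mathfrak{C})\circ(\mathfrak{D}\otimes_B\mathfrak{n})\circ(\Delta_{\mathfrak{D}}\otimes_BN)=(N\otimes_A\Delta_{\mathfrak{C}})\circ\mathfrak{n},$$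 $$(\eta\otimes_A\mathfrak{C})\circ(\mathfrak{C}\otimes_AM\otimes_B\mathfrak{n})\circ(\mathfrak{C}\otimes_A\mathfrak{m}\otimes_BN)\circ(\Delta_{\mathfrak{C}}\otimes_AM\otimes_BN)=(\mathfrak{C}\otimes_A\eta)\circ(\Delta_{\mathfrak{C}}\otimes_AM\otimes_BN),$$ $$(\rho\otimes_B\mathfrak{D})\circ(\mathfrak{D}\otimes_BN\otimes_A\mathfrak{m})\circ(\mathfrak{D}\otimes_B\mathfrak{n}\otimes_AM)\circ(\Delta_{\mathfrak{D}}\otimes_BN\otimes_AM)=(\mathfrak{D}\otimes_B\rho)\circ(\Delta_{\mathfrak{D}}\otimes_BN\otimes_AM),$$ $$\eta\otimes_AM=(M\otimes_B\rho)\circ(\mathfrak{m}\otimes_BN\otimes_AM),\qquad\rho\otimes_BN=(N\otimes_A\eta)\circ(\mathfrak{n}\otimes_AM\otimes_BN).$$ *)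

(* Defs.v *)
From HB Require Import structures.
From mathcomp Require Import all_boot all_algebra.
From mathcomp Require Import generic_quotient boolp.

Set Implicit Arguments.
Unset Strict Implicit.
Unset Printing Implicit Defensive.

Import GRing.Theory.
Local Open Scope ring_scope.
Local Open Scope quotient_scope.

(* A right A-module is an lmodType over the converse ring A^c: for a : A, the
   product x.a is written  a *: x.  All rings are pzRingType's, so the zero ring
   is allowed. *)

Record bimod (A B : pzRingType) := Bimod {
  bm_mod :> lmodType B^c;
  lact : A -> bm_mod -> bm_mod;
  lact1 : forall m, lact 1 m = m;
  lactA : forall a a' m, lact a (lact a' m) = lact (a * a') m;
  lactDl : forall a a' m, lact (a + a') m = lact a m + lact a' m;
  lactDr : forall a m m', lact a (m + m') = lact a m + lact a m';
  lactZ : forall a (b : B^c) m, lact a (b *: m) = b *: lact a m }.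

Record bihom (A B : pzRingType) (M N : bimod A B) := Bihom {
  bh_fun :> {linear M -> N};
  bh_lact : forall a m, bh_fun (lact a m) = lact a (bh_fun m) }.

Lemma lact0 (A B : pzRingType) (M : bimod A B) (a : A) : lact a (0 : M) = 0.
Proof. by apply: (addrI (lact a 0)); rewrite -lactDr !addr0. Qed.

Definition bid (A B : pzRingType) (M : bimod A B) : bihom M M :=
  @Bihom A B M M idfun (fun _ _ => erefl).

Lemma bcomp_lact (A B : pzRingType) (M N P : bimod A B)
    (g : bihom N P) (f : bihom M N) a m :
  (g \o f) (lact a m) = lact a ((g \o f) m).
Proof. by rewrite /= !bh_lact. Qed.

Definition bcomp (A B : pzRingType) (M N P : bimod A B)
    (g : bihom N P) (f : bihom M N) : bihom M P :=
  @Bihom A B M P (g \o f) (bcomp_lact g f).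

Section RegularBimodule.
Variable A : pzRingType.

Definition reg_lact (a : A) (x : A^c^o) : A^c^o := (a * (x : A) : A).

Lemma reg_lact1 x : reg_lact 1 x = x. Proof. exact: (@mul1r A). Qed.
Lemma reg_lactA a b x : reg_lact a (reg_lact b x) = reg_lact (a * b) x.
Proof. exact: (@mulrA A). Qed.
Lemma reg_lactDl a b x : reg_lact (a + b) x = reg_lact a x + reg_lact b x.
Proof. exact: (@mulrDl A). Qed.
Lemma reg_lactDr a x y : reg_lact a (x + y) = reg_lact a x + reg_lact a y.
Proof. exact: (@mulrDr A). Qed.
Lemma reg_lactZ a (b : A^c) x : reg_lact a (b *: x) = b *: reg_lact a x.
Proof. exact: (@mulrA A). Qed.

Definition regbimod : bimod A A :=
  Bimod reg_lact1 reg_lactA reg_lactDl reg_lactDr reg_lactZ.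
End RegularBimodule.

(* The tensor product of a right A-module X and an (A,B)-bimodule M is the
   quotient of the formal sums of pairs (words in X * M) by the congruence
   generated by the bilinearity relations.  Formal opposites are not needed,
   since - (x (x) m) = (- x) (x) m. *)
Section Tensor.
Variables (A B : pzRingType) (X : lmodType A^c) (M : bimod A B).
Local Notation word := (seq (X * M)).

Inductive tens_rel : word -> word -> Prop :=
| tens_refl s : tens_rel s s
| tens_sym s t : tens_rel s t -> tens_rel t s
| tens_trans s t u : tens_rel s t -> tens_rel t u -> tens_rel s u
| tens_cat s t s' t' :
    tens_rel s t -> tens_rel s' t' -> tens_rel (s ++ s') (t ++ t')
| tens_catC s t : tens_rel (s ++ t) (t ++ s)
| tens_0l m : tens_rel [:: (0, m)] [::]
| tens_Dl x x' m : tens_rel [:: (x + x', m)] [:: (x, m); (x', m)]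
| tens_Dr x m m' : tens_rel [:: (x, m + m')] [:: (x, m); (x, m')]
| tens_bal x (a : A) m : tens_rel [:: ((a : A^c) *: x, m)] [:: (x, lact a m)].

Definition tens_relb : rel word := fun s t => `[< tens_rel s t >].

Lemma tens_relb_refl : reflexive tens_relb.
Proof. by move=> s; apply/asboolP; exact: tens_refl. Qed.
Lemma tens_relb_sym : symmetric tens_relb.
Proof. by move=> s t; apply/asboolP/asboolP; exact: tens_sym. Qed.
Lemma tens_relb_trans : transitive tens_relb.
Proof. by move=> s t u /asboolP st /asboolP tu; apply/asboolP; exact: tens_trans tu. Qed.

Canonical tens_equiv :=
  EquivRel tens_relb tens_relb_refl tens_relb_sym tens_relb_trans.

Definition tens_car : Type := {eq_quot tens_equiv}.
HB.instance Definition _ := Choice.on tens_car.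

Definition tword (s : word) : tens_car := \pi_{eq_quot tens_equiv} s.

Lemma tword_eq s t : tword s = tword t <-> tens_rel s t.
Proof.
rewrite /tword; split=> [/eqquotP/asboolP //|st].
by apply/eqquotP/asboolP.
Qed.

Lemma tword_repr (t : tens_car) : tword (repr t) = t.
Proof. exact: reprK. Qed.

Lemma repr_tword s : tens_rel (repr (tword s)) s.
Proof. by apply/tword_eq; rewrite tword_repr. Qed.

Definition tens_add (t u : tens_car) : tens_car := tword (repr t ++ repr u).

Lemma tens_addE s t : tens_add (tword s) (tword t) = tword (s ++ t).
Proof. by apply/tword_eq/tens_cat; exact: repr_tword. Qed.

Fact tens_rel_map (f : X * M -> X * M) :
    (forall m, tens_rel [:: f (0, m)] [::]) ->
    (forall x x' m, tens_rel [:: f (x + x', m)] [:: f (x, m); f (x', m)]) ->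
    (forall x m m', tens_rel [:: f (x, m + m')] [:: f (x, m); f (x, m')]) ->
    (forall x (a : A) m,
       tens_rel [:: f ((a : A^c) *: x, m)] [:: f (x, lact a m)]) ->
  forall s t, tens_rel s t -> tens_rel (map f s) (map f t).
Proof.
move=> f0 fDl fDr fb s t; elim=> {s t} //=.
- by move=> s; exact: tens_refl.
- by move=> s t _; exact: tens_sym.
- by move=> s t u _ st _; exact: tens_trans.
- by move=> s t s' t' _ st _ st'; rewrite !map_cat; exact: tens_cat.
- by move=> s t; rewrite !map_cat; exact: tens_catC.
Qed.

Definition tens_opp (t : tens_car) : tens_car :=
  tword [seq (- p.1, p.2) | p <- repr t].

Lemma tens_oppE s : tens_opp (tword s) = tword [seq (- p.1, p.2) | p <- s].
Proof.
apply/tword_eq/(@tens_rel_map (fun p => (- p.1, p.2))) => /=; last exact: repr_tword.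
- by move=> m; rewrite oppr0; exact: tens_0l.
- by move=> x x' m; rewrite opprD; exact: tens_Dl.
- by move=> x m m'; exact: tens_Dr.
- by move=> x a m; rewrite -scalerN; exact: tens_bal.
Qed.

Lemma tens_addA : associative tens_add.
Proof.
move=> t u v; rewrite -(tword_repr t) -(tword_repr u) -(tword_repr v).
by rewrite !tens_addE catA.
Qed.
Lemma tens_addC : commutative tens_add.
Proof.
move=> t u; rewrite -(tword_repr t) -(tword_repr u) !tens_addE.
exact/tword_eq/tens_catC.
Qed.
Lemma tens_add0 : left_id (tword [::]) tens_add.
Proof. by move=> t; rewrite -(tword_repr t) tens_addE. Qed.
Lemma tens_addN : left_inverse (tword [::]) tens_opp tens_add.
Proof.
move=> t; rewrite -(tword_repr t); elim: (repr t) => [|[x m] s IHs].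
  by rewrite tens_oppE tens_addE.
have consE y n u : tword ((y, n) :: u) = tens_add (tword [:: (y, n)]) (tword u).
  by rewrite tens_addE.
move: IHs; rewrite !tens_oppE /= !(consE _ _ s) consE => IHs.
rewrite -tens_addA [tens_add _ (tens_add (tword [:: _]) _)]tens_addA.
rewrite [tens_add (tword [seq _ | _ <- _]) _]tens_addC -tens_addA IHs.
rewrite tens_addA tens_addE [RHS](_ : _ = tens_add (tword [::]) (tword [::])); last first.
  by rewrite tens_add0.
congr tens_add; apply/tword_eq/(tens_trans _ (tens_0l m)).
by rewrite -(addNr x); apply/tens_sym/tens_Dl.
Qed.

HB.instance Definition _ :=
  GRing.isZmodule.Build tens_car tens_addA tens_addC tens_add0 tens_addN.

Definition tens_scale (b : B^c) (t : tens_car) : tens_car :=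
  tword [seq (p.1, b *: p.2) | p <- repr t].

Lemma tens_scaleE b s : tens_scale b (tword s) = tword [seq (p.1, b *: p.2) | p <- s].
Proof.
apply/tword_eq/(@tens_rel_map (fun p => (p.1, b *: p.2))) => /=; last exact: repr_tword.
- by move=> m; exact: tens_0l.
- by move=> x x' m; exact: tens_Dl.
- by move=> x m m'; rewrite scalerDr; exact: tens_Dr.
- by move=> x a m; rewrite -lactZ; exact: tens_bal.
Qed.

Lemma tens_scaleA b c t : tens_scale b (tens_scale c t) = tens_scale (b * c) t.
Proof.
rewrite -(tword_repr t) !tens_scaleE -map_comp; congr tword.
by apply: eq_map => p /=; rewrite scalerA.
Qed.
Lemma tens_scale1 : left_id 1 tens_scale.
Proof.
move=> t; rewrite -[RHS]tword_repr -(tword_repr t) tens_scaleE tword_repr; congr tword.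
by rewrite -[RHS]map_id; apply: eq_map => -[x m] /=; rewrite scale1r.
Qed.
Lemma tens_scaleDr : right_distributive tens_scale +%R.
Proof.
move=> b t u; rewrite -(tword_repr t) -(tword_repr u).
by rewrite [tword _ + tword _]tens_addE !tens_scaleE map_cat [RHS]tens_addE.
Qed.
Lemma tens_scaleDl t : {morph tens_scale^~ t : b c / b + c}.
Proof.
move=> b c; rewrite -(tword_repr t) !tens_scaleE [RHS]tens_addE; apply/tword_eq.
elim: (repr t) => [|[x m] s IHs] /=; first exact: tens_refl.
rewrite scalerDl -[X in tens_rel X _]cat1s.
apply: tens_trans (tens_cat (tens_Dr _ _ _) IHs) _.
rewrite -(cat1s _ (_ ++ _)) -(cat1s (x, b *: m) [:: _]) -!catA.
apply: tens_cat; first exact: tens_refl.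
rewrite -[X in tens_rel _ (_ ++ X)]cat1s !catA.
by apply: tens_cat; [exact: tens_catC|exact: tens_refl].
Qed.

HB.instance Definition _ := GRing.Zmodule_isLmodule.Build B^c tens_car
  tens_scaleA tens_scale1 tens_scaleDr tens_scaleDl.

Definition tens : lmodType B^c := tens_car.

Definition pure (x : X) (m : M) : tens := tword [:: (x, m)].

Lemma pureDl x x' m : pure (x + x') m = pure x m + pure x' m.
Proof. by rewrite [RHS]tens_addE; exact/tword_eq/tens_Dl. Qed.
Lemma pureDr x m m' : pure x (m + m') = pure x m + pure x m'.
Proof. by rewrite [RHS]tens_addE; exact/tword_eq/tens_Dr. Qed.
Lemma pure0l m : pure 0 m = 0.
Proof. exact/tword_eq/tens_0l. Qed.
Lemma pure0r x : pure x 0 = 0.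
Proof. by apply: (addrI (pure x 0)); rewrite -pureDr !addr0. Qed.
Lemma pure_bal (a : A) x m : pure ((a : A^c) *: x) m = pure x (lact a m).
Proof. exact/tword_eq/tens_bal. Qed.
Lemma pureZ (b : B^c) x m : pure x (b *: m) = b *: pure x m.
Proof. by rewrite [RHS]tens_scaleE. Qed.

Lemma tens_sumE (t : tens) : t = \sum_(p <- repr t) pure p.1 p.2.
Proof.
rewrite -[LHS]tword_repr; elim: (repr t) => [|[x m] s IHs].
  by rewrite big_nil.
by rewrite big_cons -IHs [RHS]tens_addE.
Qed.

Lemma tens_ind (P : tens -> Prop) :
  P 0 -> (forall t u, P t -> P u -> P (t + u)) -> (forall x m, P (pure x m)) ->
  forall t, P t.
Proof. by move=> P0 PD Pp t; rewrite (tens_sumE t); apply: big_ind. Qed.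

Record balanced (G : zmodType) (f : X -> M -> G) : Prop := Balanced {
  bal_Dl : forall x x' m, f (x + x') m = f x m + f x' m;
  bal_Dr : forall x m m', f x (m + m') = f x m + f x m';
  bal_lact : forall x (a : A) m, f ((a : A^c) *: x) m = f x (lact a m) }.

Definition tlift (G : zmodType) (f : X -> M -> G) (t : tens) : G :=
  \sum_(p <- repr t) f p.1 p.2.

Section Lift.
Variables (G : zmodType) (f : X -> M -> G) (bf : balanced f).

Lemma tlift_word s : tlift f (tword s) = \sum_(p <- s) f p.1 p.2.
Proof.
rewrite /tlift; move: (repr (tword s)) (repr_tword s) => t; elim=> {s t} //=.
- by move=> s t u _ -> _ ->.
- by move=> s t s' t' _ e _ e'; rewrite !big_cat /= e e'.
- by move=> s t; rewrite !big_cat /= addrC.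
- move=> m; rewrite big_nil big_seq1 /=.
  by apply: (addrI (f 0 m)); rewrite -(bal_Dl bf) !addr0.
- by move=> x x' m; rewrite !big_cons !big_nil /= !addr0 (bal_Dl bf).
- by move=> x m m'; rewrite !big_cons !big_nil /= !addr0 (bal_Dr bf).
- by move=> x a m; rewrite !big_seq1 /= (bal_lact bf).
Qed.

Lemma tliftE x m : tlift f (pure x m) = f x m.
Proof. by rewrite tlift_word big_seq1. Qed.

Lemma tliftD t u : tlift f (t + u) = tlift f t + tlift f u.
Proof.
rewrite -(tword_repr t) -(tword_repr u) [tword _ + tword _]tens_addE.
by rewrite !tlift_word big_cat.
Qed.

Lemma tlift0 : tlift f 0 = 0.
Proof. by apply: (addrI (tlift f 0)); rewrite -tliftD !addr0. Qed.
End Lift.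

Lemma tlift_linear (Y : lmodType B^c) (f : X -> M -> Y) :
  balanced f -> (forall (b : B^c) x m, f x (b *: m) = b *: f x m) ->
  linear (tlift f).
Proof.
move=> bf fZ b t u; rewrite (tliftD bf); congr (_ + _).
elim/tens_ind: t => [|t v IHt IHv|x m]; first by rewrite scaler0 (tlift0 bf) scaler0.
  by rewrite scalerDr !(tliftD bf) scalerDr IHt IHv.
by rewrite -pureZ !(tliftE bf) fZ.
Qed.

Lemma tens_ext (Y : lmodType B^c) (f g : {linear tens -> Y}) :
  (forall x m, f (pure x m) = g (pure x m)) -> f =1 g.
Proof.
move=> fg t; elim/tens_ind: t => [|t u IHt IHu|x m]; last exact: fg.
  by rewrite !linear0.
by rewrite !linearD IHt IHu.
Qed.
End Tensor.

Arguments pure {A B X M} x m.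

(* The linear map induced by a balanced map that is linear in its second
   argument; locked to keep conversion checks fast. *)
HB.lock Definition tlin (A B : pzRingType) (X : lmodType A^c) (M : bimod A B)
    (Y : lmodType B^c) (f : X -> M -> Y) (bf : balanced f)
    (fZ : forall (b : B^c) x m, f x (b *: m) = b *: f x m) :
    {linear tens X M -> Y} :=
  HB.pack (tlift f) (GRing.isLinear.Build B^c (tens X M) Y *:%R (tlift f)
                       (tlift_linear bf fZ)).

Lemma tlinE (A B : pzRingType) (X : lmodType A^c) (M : bimod A B)
    (Y : lmodType B^c) (f : X -> M -> Y) (bf : balanced f)
    (fZ : forall (b : B^c) x m, f x (b *: m) = b *: f x m) x m :
  tlin bf fZ (pure x m) = f x m.
Proof. by rewrite tlin.unlock; exact: tliftE. Qed.

Section TensorBimodule.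
Variables (R A B : pzRingType) (P : bimod R A) (M : bimod A B).

Definition tens_lact (r : R) : tens P M -> tens P M :=
  tlift (fun x m => pure (lact r x) m).

Lemma tens_lact_bal r : balanced (fun (x : P) (m : M) => pure (lact r x) m).
Proof.
split=> [x x' m|x m m'|x a m].
- by rewrite lactDr pureDl.
- exact: pureDr.
- by rewrite lactZ pure_bal.
Qed.

Lemma tens_lactE r x m : tens_lact r (pure x m) = pure (lact r x) m.
Proof. exact: tliftE (tens_lact_bal r) _ _. Qed.

Lemma tens_lactDr r t u : tens_lact r (t + u) = tens_lact r t + tens_lact r u.
Proof. exact: tliftD (tens_lact_bal r) _ _. Qed.

Lemma tens_lact0 r : tens_lact r 0 = 0.
Proof. exact: tlift0 (tens_lact_bal r). Qed.

Lemma tens_lact1 t : tens_lact 1 t = t.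
Proof.
elim/tens_ind: t => [|t u IHt IHu|x m]; first exact: tens_lact0.
  by rewrite tens_lactDr IHt IHu.
by rewrite tens_lactE lact1.
Qed.

Lemma tens_lactA r s t : tens_lact r (tens_lact s t) = tens_lact (r * s) t.
Proof.
elim/tens_ind: t => [|t u IHt IHu|x m]; first by rewrite !tens_lact0.
  by rewrite !tens_lactDr IHt IHu.
by rewrite !tens_lactE lactA.
Qed.

Lemma tens_lactDl r s t : tens_lact (r + s) t = tens_lact r t + tens_lact s t.
Proof.
elim/tens_ind: t => [|t u IHt IHu|x m]; first by rewrite !tens_lact0 addr0.
  by rewrite !tens_lactDr IHt IHu addrACA.
by rewrite !tens_lactE lactDl pureDl.
Qed.

Lemma tens_lactZ r (b : B^c) t : tens_lact r (b *: t) = b *: tens_lact r t.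
Proof.
elim/tens_ind: t => [|t u IHt IHu|x m]; first by rewrite scaler0 tens_lact0 scaler0.
  by rewrite scalerDr !tens_lactDr IHt IHu scalerDr.
by rewrite -pureZ !tens_lactE pureZ.
Qed.

Definition btens : bimod R B :=
  Bimod tens_lact1 tens_lactA tens_lactDl tens_lactDr tens_lactZ.
End TensorBimodule.
Canonical btens.

Section TensorMap.
Variables (A B : pzRingType) (X X' : lmodType A^c) (M M' : bimod A B).
Variables (f : {linear X -> X'}) (g : bihom M M').

Lemma tmap_bal : balanced (fun (x : X) (m : M) => pure (f x) (g m)).
Proof.
split=> [x x' m|x m m'|x a m].
- by rewrite linearD pureDl.
- by rewrite linearD pureDr.
- by rewrite linearZ pure_bal bh_lact.
Qed.

Lemma tmapZ (b : B^c) x m : pure (f x) (g (b *: m)) = b *: pure (f x) (g m).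
Proof. by rewrite linearZ pureZ. Qed.

Definition tmap : {linear tens X M -> tens X' M'} := tlin tmap_bal tmapZ.

Lemma tmapE x m : tmap (pure x m) = pure (f x) (g m).
Proof. exact: tlinE. Qed.
End TensorMap.

Lemma tmap_id (A B : pzRingType) (X : lmodType A^c) (M : bimod A B) :
  tmap (idfun : {linear X -> X}) (bid M) =1 id.
Proof.
apply: (@tens_ext _ _ _ _ _ (tmap idfun (bid M)) idfun) => x m.
exact: (tmapE idfun (bid M)).
Qed.

Section TensorBihom.
Variables (R A B : pzRingType) (P P' : bimod R A) (M M' : bimod A B).
Variables (f : bihom P P') (g : bihom M M').

Lemma btmap_lact r (t : btens P M) :
  (tmap f g : _ -> btens P' M') (lact r t) = lact r (tmap f g t : btens P' M').
Proof.
elim/tens_ind: t => [|t u IHt IHu|x m].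
- by rewrite lact0 linear0 lact0.
- by rewrite lactDr linearD IHt IHu linearD lactDr.
- by rewrite [lact r _]tens_lactE !tmapE bh_lact [RHS]tens_lactE.
Qed.

Definition btmap : bihom (btens P M) (btens P' M') := Bihom btmap_lact.
End TensorBihom.

Section Associator.
Variables (A B R : pzRingType) (X : lmodType A^c) (M : bimod A B) (N : bimod B R).

Lemma assoc1_bal (n : N) :
  balanced (fun (x : X) (m : M) => pure x (pure m n : btens M N)).
Proof.
split=> [x x' m|x m m'|x a m].
- exact: pureDl.
- by rewrite pureDl pureDr.
- by rewrite pure_bal /= tens_lactE.
Qed.

Lemma assoc_bal :
  balanced (fun (t : tens X M) (n : N) =>
              tlift (fun x m => pure x (pure m n : btens M N)) t).
Proof.
split=> [t u n|t n n'|t b n].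
- exact: tliftD (assoc1_bal n) _ _.
- elim/tens_ind: t => [|t u IHt IHu|x m].
  + by rewrite !(tlift0 (assoc1_bal _)) addr0.
  + by rewrite !(tliftD (assoc1_bal _)) IHt IHu addrACA.
  + by rewrite !(tliftE (assoc1_bal _)) pureDr pureDr.
- elim/tens_ind: t => [|t u IHt IHu|x m].
  + by rewrite scaler0 !(tlift0 (assoc1_bal _)).
  + by rewrite scalerDr !(tliftD (assoc1_bal _)) IHt IHu.
  + by rewrite -pureZ !(tliftE (assoc1_bal _)) pure_bal.
Qed.

Lemma assocZ (r : R^c) (t : tens X M) (n : N) :
  tlift (fun x m => pure x (pure m (r *: n) : btens M N)) t =
  r *: tlift (fun x m => pure x (pure m n : btens M N)) t.
Proof.
elim/tens_ind: t => [|t u IHt IHu|x m].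
- by rewrite !(tlift0 (assoc1_bal _)) scaler0.
- by rewrite !(tliftD (assoc1_bal _)) IHt IHu scalerDr.
- by rewrite !(tliftE (assoc1_bal _)) -pureZ -pureZ.
Qed.

Definition assoc : {linear tens (tens X M) N -> tens X (btens M N)} :=
  tlin assoc_bal assocZ.

Lemma assocE x m n : assoc (pure (pure x m) n) = pure x (pure m n : btens M N).
Proof.
by rewrite [LHS]tlinE (tliftE (assoc1_bal n)).
Qed.

Lemma assocV1_bal (x : X) :
  balanced (fun (m : M) (n : N) => pure (pure x m) n).
Proof.
split=> [m m' n|m n n'|m b n].
- by rewrite pureDr pureDl.
- exact: pureDr.
- by rewrite pureZ pure_bal.
Qed.

Lemma assocV_bal :
  balanced (fun (x : X) (t : btens M N) => tlift (fun m n => pure (pure x m) n) t).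
Proof.
split=> [x x' t|x t u|x a t].
- elim/tens_ind: t => [|t u IHt IHu|m n].
  + by rewrite !(tlift0 (assocV1_bal _)) addr0.
  + by rewrite !(tliftD (assocV1_bal _)) IHt IHu addrACA.
  + by rewrite !(tliftE (assocV1_bal _)) pureDl pureDl.
- exact: tliftD (assocV1_bal x) _ _.
- elim/tens_ind: t => [|t u IHt IHu|m n].
  + by rewrite /= tens_lact0 !(tlift0 (assocV1_bal _)).
  + by rewrite lactDr !(tliftD (assocV1_bal _)) IHt IHu.
  + by rewrite /= tens_lactE !(tliftE (assocV1_bal _)) pure_bal.
Qed.

Lemma assocVZ (r : R^c) (x : X) (t : btens M N) :
  tlift (fun m n => pure (pure x m) n) (r *: t) =
  r *: tlift (fun m n => pure (pure x m) n) t.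
Proof.
elim/tens_ind: t => [|t u IHt IHu|m n].
- by rewrite scaler0 !(tlift0 (assocV1_bal _)) scaler0.
- by rewrite scalerDr !(tliftD (assocV1_bal _)) IHt IHu scalerDr.
- by rewrite -pureZ !(tliftE (assocV1_bal _)) pureZ.
Qed.

Definition assocV : {linear tens X (btens M N) -> tens (tens X M) N} :=
  tlin assocV_bal assocVZ.

Lemma assocVE x m n :
  assocV (pure x (pure m n : btens M N)) = pure (pure x m) n.
Proof.
by rewrite [LHS]tlinE (tliftE (assocV1_bal x)).
Qed.

Lemma assocK : cancel assoc assocV.
Proof.
move=> t; elim/tens_ind: t => [|t u IHt IHu|t n]; first by rewrite !linear0.
  by rewrite !linearD IHt IHu.
elim/tens_ind: t => [|t u IHt IHu|x m]; last by rewrite assocE assocVE.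
  by rewrite pure0l !linear0.
by rewrite pureDl !linearD IHt IHu.
Qed.

Lemma assocVK : cancel assocV assoc.
Proof.
move=> t; elim/tens_ind: t => [|t u IHt IHu|x t]; first by rewrite !linear0.
  by rewrite !linearD IHt IHu.
elim/tens_ind: t => [|t u IHt IHu|m n]; last by rewrite assocVE assocE.
  by rewrite pure0r !linear0.
by rewrite pureDr !linearD IHt IHu.
Qed.
End Associator.

Arguments assoc {A B R} X M N.
Arguments assocV {A B R} X M N.

Section LeftUnitor.
Variables (A B : pzRingType) (M : bimod A B).

Lemma lunit_bal : balanced (fun (a : regbimod A) (m : M) => lact (a : A) m).
Proof.
split=> [a a' m|a m m'|x a m].
- exact: lactDl.
- exact: lactDr.
- by rewrite lactA.
Qed.

Lemma lunitZ (b : B^c) (a : regbimod A) (m : M) :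
  lact (a : A) (b *: m) = b *: lact (a : A) m.
Proof. exact: lactZ. Qed.

Definition lunit : {linear tens (regbimod A) M -> M} := tlin lunit_bal lunitZ.

Lemma lunitE (a : regbimod A) m : lunit (pure a m) = lact (a : A) m.
Proof. exact: tlinE. Qed.

Lemma lunit_lact a (t : btens (regbimod A) M) :
  (lunit : btens (regbimod A) M -> M) (lact a t) = lact a (lunit t).
Proof.
elim/tens_ind: t => [|t u IHt IHu|x m].
- by rewrite lact0 linear0 lact0.
- by rewrite lactDr !linearD lactDr IHt IHu.
- by rewrite [lact a _]tens_lactE !lunitE lactA.
Qed.

Definition blunit : bihom (btens (regbimod A) M) M := Bihom lunit_lact.
End LeftUnitor.

Section RightUnitor.
Variables (A : pzRingType) (X : lmodType A^c).

Lemma runit_bal : balanced (fun (x : X) (a : regbimod A) => (a : A^c) *: x).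
Proof.
split=> [x x' a|x a a'|x a a'].
- exact: scalerDr.
- exact: scalerDl.
- by rewrite scalerA.
Qed.

Lemma runitZ (b : A^c) (x : X) (a : regbimod A) :
  ((b *: a : regbimod A) : A^c) *: x = b *: ((a : A^c) *: x).
Proof. by rewrite scalerA. Qed.

Definition runit : {linear tens X (regbimod A) -> X} := tlin runit_bal runitZ.

Lemma runitE x (a : regbimod A) : runit (pure x a) = (a : A^c) *: x.
Proof. exact: tlinE. Qed.
End RightUnitor.

Arguments lunit {A B} M.
Arguments blunit {A B} M.
Arguments runit {A} X.

Record coring (A : pzRingType) := Coring {
  cor_bimod :> bimod A A;
  Delta : bihom cor_bimod (btens cor_bimod cor_bimod);
  eps : bihom cor_bimod (regbimod A);
  cor_coassoc :
    tmap (bid cor_bimod) Delta \o Delta =1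
    assoc cor_bimod cor_bimod cor_bimod \o tmap Delta (bid cor_bimod) \o Delta;
  cor_counitr : runit cor_bimod \o tmap (bid cor_bimod) eps \o Delta =1 id;
  cor_counitl : lunit cor_bimod \o tmap eps (bid cor_bimod) \o Delta =1 id }.

Arguments Delta {A} c.
Arguments eps {A} c.

Section Comodules.
Variables (A : pzRingType) (C : coring A).

Definition is_coaction (X : lmodType A^c) (rho : {linear X -> tens X C}) : Prop :=
  (assoc X C C \o tmap rho (bid C) \o rho =1 tmap idfun (Delta C) \o rho) /\
  (runit X \o tmap idfun (eps C) \o rho =1 id).

Record comod := Comod {
  cm_mod :> lmodType A^c;
  coact : {linear cm_mod -> tens cm_mod C};
  coactP : is_coaction coact }.

Record colin (X Y : comod) := Colin {
  cl_fun :> {linear X -> Y};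
  colinP : coact Y \o cl_fun =1 tmap cl_fun (bid C) \o coact X }.
End Comodules.

Lemma coring_coactP (A : pzRingType) (C : coring A) :
  is_coaction (Delta C : {linear C -> tens C C}).
Proof. by split=> x; [exact/esym/cor_coassoc|exact: cor_counitr]. Qed.

Definition coring_comod (A : pzRingType) (C : coring A) : comod C :=
  Comod (coring_coactP C).

(* An (A,D)-bicomodule, A being the trivial A-coring. *)
Record bicomod (A B : pzRingType) (D : coring B) := Bicomod {
  bc_bimod :> bimod A B;
  bcoact : bihom bc_bimod (btens bc_bimod D);
  bcoactP : is_coaction (bcoact : {linear bc_bimod -> tens bc_bimod D}) }.

Arguments bcoact {A B D} b.

Record precat := PreCat {
  Ob :> Type;
  Hom : Ob -> Ob -> zmodType;
  idm : forall X, Hom X X;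
  cmp : forall X Y Z, Hom Y Z -> Hom X Y -> Hom X Z;
  cmp1m : forall X Y (f : Hom X Y), cmp (idm Y) f = f;
  cmpm1 : forall X Y (f : Hom X Y), cmp f (idm X) = f;
  cmpA : forall X Y Z T (h : Hom Z T) (g : Hom Y Z) (f : Hom X Y),
    cmp h (cmp g f) = cmp (cmp h g) f;
  cmpDl : forall X Y Z (g g' : Hom Y Z) (f : Hom X Y),
    cmp (g + g') f = cmp g f + cmp g' f;
  cmpDr : forall X Y Z (g : Hom Y Z) (f f' : Hom X Y),
    cmp g (f + f') = cmp g f + cmp g f' }.

Arguments Hom {p} X Y.
Arguments idm {p} X.
Arguments cmp {p X Y Z} g f.

Record functor (K L : precat) := Functor {
  fobj :> K -> L;
  fmap : forall X Y, Hom X Y -> Hom (fobj X) (fobj Y);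
  fmap1 : forall X, fmap (idm X) = idm (fobj X);
  fmap_cmp : forall X Y Z (g : Hom Y Z) (f : Hom X Y),
    fmap (cmp g f) = cmp (fmap g) (fmap f) }.

Arguments fmap {K L} _ {X Y} _.

Definition fid (K : precat) : functor K K :=
  @Functor K K id (fun X Y f => f) (fun=> erefl) (fun _ _ _ _ _ => erefl).

Section Fcomp.
Variables (K L P : precat) (G : functor L P) (F : functor K L).

Lemma fcomp1 X : fmap G (fmap F (idm X)) = idm (G (F X)).
Proof. by rewrite !fmap1. Qed.
Lemma fcomp_cmp X Y Z (g : Hom Y Z) (f : Hom X Y) :
  fmap G (fmap F (cmp g f)) = cmp (fmap G (fmap F g)) (fmap G (fmap F f)).
Proof. by rewrite !fmap_cmp. Qed.

Definition fcomp : functor K P :=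
  @Functor K P (fun X => G (F X)) (fun X Y f => fmap G (fmap F f)) fcomp1 fcomp_cmp.
End Fcomp.

Record nattrans (K L : precat) (F G : functor K L) := NatTrans {
  ntc :> forall X, Hom (F X) (G X);
  nt_nat : forall X Y (f : Hom X Y), cmp (fmap G f) (ntc X) = cmp (ntc Y) (fmap F f) }.

Definition additive_functor (K L : precat) (F : functor K L) : Prop :=
  forall (X Y : K) (f g : Hom X Y), fmap F (f + g) = fmap F f + fmap F g.

Definition is_cokernel (K : precat) (X Y Z : K) (f : Hom X Y) (c : Hom Y Z) : Prop :=
  cmp c f = 0 /\
  forall (T : K) (g : Hom Y T), cmp g f = 0 -> exists! h : Hom Z T, cmp h c = g.

Definition preserves_cokernels (K L : precat) (F : functor K L) : Prop :=
  forall (X Y Z : K) (f : Hom X Y) (c : Hom Y Z),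
    is_cokernel f c -> is_cokernel (fmap F f) (fmap F c).

Definition is_direct_sum (K : precat) (I : Type) (X : I -> K) (S : K)
    (inj : forall i, Hom (X i) S) : Prop :=
  forall (T : K) (g : forall i, Hom (X i) T),
    exists! h : Hom S T, forall i, cmp h (inj i) = g i.

Definition preserves_direct_sums (K L : precat) (F : functor K L) : Prop :=
  forall (I : Type) (X : I -> K) (S : K) (inj : forall i, Hom (X i) S),
    is_direct_sum inj ->
    @is_direct_sum L I (fun i => F (X i)) (F S) (fun i => fmap F (inj i)).

Section ModuleCategory.
Variable A : pzRingType.

Lemma linear_eq (X Y : lmodType A^c) (f g : {linear X -> Y}) : f =1 g -> f = g.
Proof.
case: f g => f [[a] [b]] [g [[a'] [b']]] /= /funext fg; subst g.
by rewrite (Prop_irrelevance a a') (Prop_irrelevance b b').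
Qed.

Definition mod_hom (X Y : lmodType A^c) : Type := {linear X -> Y}.
Section ModHom.
Variables X Y : lmodType A^c.
HB.instance Definition _ := gen_eqMixin (mod_hom X Y).
HB.instance Definition _ := gen_choiceMixin (mod_hom X Y).

Definition mh_add (f g : mod_hom X Y) : mod_hom X Y :=
  (f : {linear X -> Y}) \+ (g : {linear X -> Y}).
Definition mh_opp (f : mod_hom X Y) : mod_hom X Y := \- (f : {linear X -> Y}).
Definition mh_zero : mod_hom X Y := \0.

Lemma mh_addA : associative mh_add.
Proof. by move=> f g h; apply: linear_eq => x /=; rewrite addrA. Qed.
Lemma mh_addC : commutative mh_add.
Proof. by move=> f g; apply: linear_eq => x /=; rewrite addrC. Qed.
Lemma mh_add0 : left_id mh_zero mh_add.
Proof. by move=> f; apply: linear_eq => x /=; rewrite add0r. Qed.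
Lemma mh_addN : left_inverse mh_zero mh_opp mh_add.
Proof. by move=> f; apply: linear_eq => x /=; rewrite addNr. Qed.
HB.instance Definition _ :=
  GRing.isZmodule.Build (mod_hom X Y) mh_addA mh_addC mh_add0 mh_addN.
End ModHom.

Definition mh_cmp (X Y Z : lmodType A^c) (g : mod_hom Y Z) (f : mod_hom X Y) :
    mod_hom X Z :=
  (g : {linear Y -> Z}) \o (f : {linear X -> Y}).

Lemma mh_cmp1m X Y (f : mod_hom X Y) : mh_cmp (idfun : {linear Y -> Y}) f = f.
Proof. exact: linear_eq. Qed.
Lemma mh_cmpm1 X Y (f : mod_hom X Y) : mh_cmp f (idfun : {linear X -> X}) = f.
Proof. exact: linear_eq. Qed.
Lemma mh_cmpA X Y Z T (h : mod_hom Z T) (g : mod_hom Y Z) (f : mod_hom X Y) :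
  mh_cmp h (mh_cmp g f) = mh_cmp (mh_cmp h g) f.
Proof. exact: linear_eq. Qed.
Lemma mh_cmpDl X Y Z (g g' : mod_hom Y Z) (f : mod_hom X Y) :
  mh_cmp (g + g') f = mh_cmp g f + mh_cmp g' f.
Proof. exact: linear_eq. Qed.
Lemma mh_cmpDr X Y Z (g : mod_hom Y Z) (f f' : mod_hom X Y) :
  mh_cmp g (f + f') = mh_cmp g f + mh_cmp g f'.
Proof.
by apply: linear_eq => x; rewrite /= (linearD (g : {linear Y -> Z})).
Qed.

Definition ModCat : precat :=
  @PreCat (lmodType A^c) mod_hom (fun X => (idfun : {linear X -> X})) mh_cmp
    mh_cmp1m mh_cmpm1 mh_cmpA mh_cmpDl mh_cmpDr.
End ModuleCategory.

Section ComoduleCategory.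
Variables (A : pzRingType) (C : coring A).

Lemma colin_eq (X Y : comod C) (f g : colin X Y) : f =1 g -> f = g.
Proof.
case: f g => f fP [g gP] /= /linear_eq fg; subst g.
by rewrite (Prop_irrelevance fP gP).
Qed.

Section ColinGroup.
Variables X Y : comod C.
HB.instance Definition _ := gen_eqMixin (colin X Y).
HB.instance Definition _ := gen_choiceMixin (colin X Y).

Lemma colin_addP (f g : colin X Y) :
  coact Y \o (f \+ g) =1 tmap (f \+ g) (bid C) \o coact X.
Proof.
move=> x; rewrite /= linearD.
rewrite (colinP f x : coact Y (f x) = _) (colinP g x : coact Y (g x) = _) /=.
pose h : {linear tens X C -> tens Y C} := tmap f (bid C) \+ tmap g (bid C).
rewrite -[LHS]/(h (coact X x)); move: (coact X x); apply: tens_ext => y c.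
by rewrite /= !tmapE /= pureDl.
Qed.
Lemma colin_oppP (f : colin X Y) :
  coact Y \o (\- f) =1 tmap (\- f) (bid C) \o coact X.
Proof.
move=> x; rewrite /= linearN (colinP f x : coact Y (f x) = _) /=.
pose h : {linear tens X C -> tens Y C} := \- tmap f (bid C).
rewrite -[LHS]/(h (coact X x)); move: (coact X x); apply: tens_ext => y c.
rewrite /= !tmapE /=; apply/eqP; rewrite eq_sym -subr_eq0 opprK -pureDl addNr.
by rewrite pure0l.
Qed.
Lemma colin_zeroP : coact Y \o \0 =1 tmap (\0 : {linear X -> Y}) (bid C) \o coact X.
Proof.
move=> x; rewrite /= linear0.
pose h : {linear tens X C -> tens Y C} := \0.
rewrite -[LHS]/(h (coact X x)); move: (coact X x); apply: tens_ext => y c.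
by rewrite tmapE /= pure0l.
Qed.

Definition cl_add (f g : colin X Y) : colin X Y :=
  @Colin A C X Y (f \+ g) (colin_addP f g).
Definition cl_opp (f : colin X Y) : colin X Y := @Colin A C X Y (\- f) (colin_oppP f).
Definition cl_zero : colin X Y := @Colin A C X Y \0 colin_zeroP.

Lemma cl_addA : associative cl_add.
Proof. by move=> f g h; apply: colin_eq => x /=; rewrite addrA. Qed.
Lemma cl_addC : commutative cl_add.
Proof. by move=> f g; apply: colin_eq => x /=; rewrite addrC. Qed.
Lemma cl_add0 : left_id cl_zero cl_add.
Proof. by move=> f; apply: colin_eq => x /=; rewrite add0r. Qed.
Lemma cl_addN : left_inverse cl_zero cl_opp cl_add.
Proof. by move=> f; apply: colin_eq => x /=; rewrite addNr. Qed.
HB.instance Definition _ :=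
  GRing.isZmodule.Build (colin X Y) cl_addA cl_addC cl_add0 cl_addN.
End ColinGroup.

Lemma cl_idP (X : comod C) : coact X \o idfun =1 tmap idfun (bid C) \o coact X.
Proof. by move=> x; rewrite /= tmap_id. Qed.
Definition cl_id (X : comod C) : colin X X := @Colin A C X X idfun (@cl_idP X).

Lemma cl_cmpP (X Y Z : comod C) (g : colin Y Z) (f : colin X Y) :
  coact Z \o (g \o f) =1 tmap (g \o f) (bid C) \o coact X.
Proof.
move=> x; rewrite /=.
rewrite (colinP g (f x) : coact Z (g (f x)) = _) /= (colinP f x : coact Y (f x) = _) /=.
pose h : {linear tens X C -> tens Z C} := tmap g (bid C) \o tmap f (bid C).
rewrite -[LHS]/(h (coact X x)); move: (coact X x); apply: tens_ext => y c.
by rewrite /= !tmapE.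
Qed.
Definition cl_cmp (X Y Z : comod C) (g : colin Y Z) (f : colin X Y) : colin X Z :=
  @Colin A C X Z (g \o f) (cl_cmpP g f).

Lemma cl_cmp1m X Y (f : colin X Y) : cl_cmp (cl_id Y) f = f.
Proof. exact: colin_eq. Qed.
Lemma cl_cmpm1 X Y (f : colin X Y) : cl_cmp f (cl_id X) = f.
Proof. exact: colin_eq. Qed.
Lemma cl_cmpA X Y Z T (h : colin Z T) (g : colin Y Z) (f : colin X Y) :
  cl_cmp h (cl_cmp g f) = cl_cmp (cl_cmp h g) f.
Proof. exact: colin_eq. Qed.
Lemma cl_cmpDl X Y Z (g g' : colin Y Z) (f : colin X Y) :
  cl_cmp (g + g') f = cl_cmp g f + cl_cmp g' f.
Proof. exact: colin_eq. Qed.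
Lemma cl_cmpDr X Y Z (g : colin Y Z) (f f' : colin X Y) :
  cl_cmp g (f + f') = cl_cmp g f + cl_cmp g f'.
Proof. by apply: colin_eq => x; rewrite /= linearD. Qed.

Definition ComodCat : precat :=
  @PreCat (comod C) (fun X Y => colin X Y) cl_id cl_cmp
    cl_cmp1m cl_cmpm1 cl_cmpA cl_cmpDl cl_cmpDr.

Definition forget : functor ComodCat (ModCat A) :=
  @Functor ComodCat (ModCat A) (fun X : comod C => cm_mod X)
    (fun (X Y : comod C) (f : colin X Y) => cl_fun f)
    (fun=> erefl) (fun _ _ _ _ _ => erefl).
End ComoduleCategory.

Section TensorFunctor.
Variables (A B : pzRingType) (D : coring B) (M : bicomod A D).

Definition tens_coact (X : lmodType A^c) : {linear tens X M -> tens (tens X M) D} :=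
  assocV X M D \o tmap idfun (bcoact M).

Lemma tens_coact_pure (X : lmodType A^c) (x : X) m :
  tens_coact X (pure x m) = assocV X M D (pure x (bcoact M m)).
Proof. by rewrite /= tmapE. Qed.

Lemma tens_coactP (X : lmodType A^c) : is_coaction (tens_coact X).
Proof.
have [coM counM] := bcoactP M; split.
- have assoc_assocV (x : X) (u : btens M D) d :
      assoc (tens X M) D D (pure (assocV X M D (pure x u)) d) =
      assocV X M (btens D D) (pure x (assoc M D D (pure u d))).
    elim/tens_ind: u => [|u v IHu IHv|m d'].
    + by rewrite !(linear0, pure0l, pure0r).
    + by rewrite pureDr linearD !pureDl !linearD IHu IHv pureDr linearD.
    + by rewrite assocVE !assocE assocVE.
  have coactL (x : X) (t : btens M D) :
      assoc (tens X M) D D (tmap (tens_coact X) (bid D) (assocV X M D (pure x t))) =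
      assocV X M (btens D D) (pure x (assoc M D D (tmap (bcoact M) (bid D) t))).
    elim/tens_ind: t => [|t u IHt IHu|m d].
    + by rewrite !(linear0, pure0r).
    + by rewrite pureDr !linearD IHt IHu pureDr linearD.
    + by rewrite assocVE !tmapE tens_coact_pure assoc_assocV.
  have coactR (x : X) (t : btens M D) :
      tmap idfun (Delta D) (assocV X M D (pure x t)) =
      assocV X M (btens D D) (pure x (tmap idfun (Delta D) t)).
    elim/tens_ind: t => [|t u IHt IHu|m d].
    + by rewrite !(linear0, pure0r).
    + by rewrite pureDr !linearD IHt IHu pureDr linearD.
    + by rewrite assocVE !tmapE assocVE.
  apply: (tens_ext (f := assoc (tens X M) D D \o tmap (tens_coact X) (bid D) \o
                         tens_coact X)
            (g := tmap idfun (Delta D) \o tens_coact X)) => x m.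
  rewrite -[LHS]/(assoc (tens X M) D D
             (tmap (tens_coact X) (bid D) (tens_coact X (pure x m)))).
  rewrite -[RHS]/(tmap idfun (Delta D) (tens_coact X (pure x m))).
  by rewrite tens_coact_pure coactL coactR; congr (assocV _ _ _ (pure _ _)); exact: coM.
- have coun (x : X) (t : btens M D) :
      runit (tens X M) (tmap idfun (eps D) (assocV X M D (pure x t))) =
      pure x (runit M (tmap idfun (eps D) t)).
    elim/tens_ind: t => [|t u IHt IHu|m d].
    + by rewrite !(linear0, pure0r).
    + by rewrite pureDr !linearD IHt IHu pureDr.
    + by rewrite assocVE !tmapE !runitE pureZ.
  apply: (tens_ext (f := runit (tens X M) \o tmap idfun (eps D) \o tens_coact X)
            (g := idfun)) => x m.
  rewrite -[LHS]/(runit (tens X M) (tmap idfun (eps D) (tens_coact X (pure x m)))).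
  by rewrite tens_coact_pure coun; congr (pure _ _); exact: counM.
Qed.

Definition tens_comod (X : lmodType A^c) : comod D := Comod (tens_coactP X).

Lemma tens_colinP (X Y : lmodType A^c) (f : {linear X -> Y}) :
  coact (tens_comod Y) \o tmap f (bid M) =1
  tmap (tmap f (bid M)) (bid D) \o coact (tens_comod X).
Proof.
have nat (x : X) (t : btens M D) :
    assocV Y M D (pure (f x) t) =
    tmap (tmap f (bid M)) (bid D) (assocV X M D (pure x t)).
  elim/tens_ind: t => [|t u IHt IHu|m d].
  + by rewrite !(linear0, pure0r).
  + by rewrite !pureDr !linearD IHt IHu.
  + by rewrite !assocVE !tmapE.
apply: (tens_ext (f := tens_coact Y \o tmap f (bid M))
          (g := tmap (tmap f (bid M)) (bid D) \o tens_coact X)) => x m.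
rewrite -[LHS]/(tens_coact Y (tmap f (bid M) (pure x m))).
rewrite -[RHS]/(tmap (tmap f (bid M)) (bid D) (tens_coact X (pure x m))).
by rewrite tmapE !tens_coact_pure nat.
Qed.

Definition tens_colin (X Y : lmodType A^c) (f : {linear X -> Y}) :
    colin (tens_comod X) (tens_comod Y) :=
  @Colin B D (tens_comod X) (tens_comod Y) (tmap f (bid M)) (tens_colinP f).

Lemma tens_colin1 (X : lmodType A^c) :
  tens_colin (idfun : {linear X -> X}) = cl_id (tens_comod X).
Proof. by apply: colin_eq => t; rewrite /= tmap_id. Qed.

Lemma tens_colin_cmp (X Y Z : lmodType A^c) (g : {linear Y -> Z}) (f : {linear X -> Y}) :
  tens_colin (g \o f) = cl_cmp (tens_colin g) (tens_colin f).
Proof.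
apply: colin_eq; pose h : {linear tens X M -> tens Z M} := tmap g (bid M) \o tmap f (bid M).
by apply: (tens_ext (g := h)) => x m; rewrite /= !tmapE.
Qed.

Definition tens_functor : functor (ModCat A) (ComodCat D) :=
  @Functor (ModCat A) (ComodCat D) tens_comod tens_colin tens_colin1 tens_colin_cmp.
End TensorFunctor.

Arguments tens_functor {A B D} M.

(* Transport of a natural transformation G F -> id along F = F' and G = G'. *)
Definition nat_transport (K L : precat) (F F' : functor K L) (G G' : functor L K)
    (eF : F = F') (eG : G = G') (t : nattrans (fcomp G F) (fid K)) :
    nattrans (fcomp G' F') (fid K) :=
  let: erefl := eF in let: erefl := eG in t.

(* m : C (x)_A M -> A (x)_A M (x)_B D = M (x)_B D, the composite of
   C (x) rho^M with eps_C (x) M (x) D. *)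
Definition bicomod_entw (A B : pzRingType) (C : coring A) (D : coring B)
    (M : bicomod A D) : bihom (btens C M) (btens M D) :=
  bcomp (blunit (btens M D))
    (bcomp (btmap (eps C) (bid (btens M D))) (btmap (bid C) (bcoact M))).

(* The eight conditions on 1-cells (D : B) -> (C : A) of W(REM(Bim)) come in
   pairs exchanged by (C, M, m, eta) <-> (D, N, n, rho).  The formulas in the
   comments omit the canonical isomorphisms.  Triple tensor products are
   bracketed to the left; since tmap only needs a right linear first argument,
   tmap idfun f stands for the tensor product of an identity map with f, and
   tmap f (bid M) for that of f with the identity of M. *)
Section OneCell.

Section Half.
Variables (A B : pzRingType) (C : coring A) (D : coring B).
Variables (M : bimod A B) (N : bimod B A).
Variables (m : bihom (btens C M) (btens M D)) (n : bihom (btens D N) (btens N C)).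
Variables (eta : bihom (btens (btens C M) N) (regbimod A)).
Variables (rho : bihom (btens (btens D N) M) (regbimod B)).

(* (M (x) eps_D) m = eps_C (x) M *)
Definition entw_counit : Prop :=
  runit M \o tmap idfun (eps D) \o m =1 lunit M \o tmap (eps C) (bid M).

(* (m (x) D) (C (x) m) (Delta_C (x) M) = (M (x) Delta_D) m *)
Definition entw_comult : Prop :=
  assoc M D D \o tmap m (bid D) \o assocV C M D \o tmap idfun m \o
    assoc C C M \o tmap (Delta C) (bid M)
  =1 tmap idfun (Delta D) \o m.

(* (eta (x) C) (C (x) M (x) n) (C (x) m (x) N) (Delta_C (x) M (x) N)
   = (C (x) eta) (Delta_C (x) M (x) N) *)
Definition eval_comult : Prop :=
  lunit C \o tmap eta (bid C) \o assocV (btens C M) N C \o tmap idfun n \o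
    assoc (btens C M) D N \o tmap (assocV C M D) (bid N) \o
    tmap (tmap idfun m) (bid N) \o tmap (assoc C C M) (bid N) \o
    tmap (tmap (Delta C) (bid M)) (bid N)
  =1 runit C \o tmap idfun eta \o assoc C (btens C M) N \o
    tmap (assoc C C M) (bid N) \o tmap (tmap (Delta C) (bid M)) (bid N).

(* eta (x) M = (M (x) rho) (m (x) N (x) M) *)
Definition eval_entw : Prop :=
  lunit M \o tmap eta (bid M)
  =1 runit M \o tmap idfun rho \o assoc M (btens D N) M \o
    tmap (assoc M D N) (bid M) \o tmap (tmap m (bid N)) (bid M).
End Half.

Variables (A B : pzRingType) (C : coring A) (D : coring B).

Record is_one_cell (M : bimod A B) (N : bimod B A)
    (m : bihom (btens C M) (btens M D)) (n : bihom (btens D N) (btens N C))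
    (eta : bihom (btens (btens C M) N) (regbimod A))
    (rho : bihom (btens (btens D N) M) (regbimod B)) : Prop := OneCell {
  oc_m_counit : entw_counit m;
  oc_m_comult : entw_comult m;
  oc_n_counit : entw_counit n;
  oc_n_comult : entw_comult n;
  oc_eta_comult : eval_comult m n eta;
  oc_rho_comult : eval_comult n m rho;
  oc_eta_entw : eval_entw m eta rho;
  oc_rho_entw : eval_entw n rho eta }.
End OneCell.

(* Main.v *)
(* For a comodule X and x in X, both the coaction X -> X (x) C and the map
   c |-> x (x) c are colinear into the cofree comodule X (x) C.  Naturality of
   eta~ along these two maps, followed by X (x) eps, gives
     eta~_X (x (x) m (x) n) = x_0 eta(x_1 (x) m (x) n).
   At X = C this, together with the colinearity of eta~_C, is the compatibility
   of eta with Delta; its analogue for rho~ at C (x) M, where rho~ is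
   eta~_C (x) M, yields eta (x) M = (M (x) rho)(m (x) N (x) M) after applying
   eps_C (x) M. *)

From HB Require Import structures.
Require Import Defs.
From mathcomp Require Import all_boot all_algebra.

Set Implicit Arguments.
Unset Strict Implicit.
Unset Printing Implicit Defensive.

Import GRing.Theory.
Local Open Scope ring_scope.

(** * Cofree comodules and colinear maps out of a coring *)

Section Cofree.
Variables (A : pzRingType) (C : coring A).

(** With this bicomodule, [tens_comod coring_bicomod X] is the cofree comodule X (x) C with coaction
    X (x) Delta. *)
Definition coring_bicomod : bicomod A C := Bicomod (coring_coactP C).

Lemma coact_colinP (X : comod C) :
  coact (tens_comod coring_bicomod X) \o coact X =1
  tmap (coact X) (bid C) \o coact X.
Proof.
move=> x; have [/(_ x) /= coX _] := coactP X.
by rewrite /= -[RHS]assocK coX.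
Qed.

Definition coact_colin (X : comod C) : colin X (tens_comod coring_bicomod X) :=
  @Colin A C X (tens_comod coring_bicomod X) (coact X) (@coact_colinP X).

Section PureColin.
Variables (X : lmodType A^c) (x : X).

Lemma pure_linear : linear (pure x : C -> tens X C).
Proof. by move=> a c c'; rewrite pureDr pureZ. Qed.

HB.instance Definition _ :=
  GRing.isLinear.Build A^c C (tens X C) *:%R (pure x : C -> tens X C) pure_linear.

(** The cofree coaction acts on the factor C alone, by Delta. *)
Lemma pure_colinP :
  coact (tens_comod coring_bicomod X) \o pure x =1
  tmap (pure x : C -> tens X C) (bid C) \o coact (coring_comod C).
Proof.
move=> c /=; rewrite tmapE /=.
elim/tens_ind: (Delta C c) => [|t u IHt IHu|c1 c2].
- by rewrite pure0r !linear0.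
- by rewrite pureDr !linearD IHt IHu.
- by rewrite assocVE tmapE.
Qed.

Definition pure_colin : colin (coring_comod C) (tens_comod coring_bicomod X) :=
  @Colin A C (coring_comod C) (tens_comod coring_bicomod X) (pure x : C -> tens X C)
    pure_colinP.
End PureColin.

Section LactColin.
Variable a : A.

Lemma lact_linear : linear (lact a : C -> C).
Proof. by move=> b c c'; rewrite lactDr lactZ. Qed.

HB.instance Definition _ :=
  GRing.isLinear.Build A^c C C *:%R (lact a : C -> C) lact_linear.

(** Left linearity of Delta. Naturality along this map later makes eta~_C left linear. *)
Lemma lact_colinP :
  coact (coring_comod C) \o lact a =1
  tmap (lact a : C -> C) (bid C) \o coact (coring_comod C).
Proof.
move=> c; rewrite /= bh_lact.
elim/tens_ind: (Delta C c) => [|t u IHt IHu|c1 c2].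
- by rewrite lact0 linear0.
- by rewrite lactDr linearD IHt IHu.
- by rewrite [LHS]tens_lactE tmapE.
Qed.

Definition lact_colin : colin (coring_comod C) (coring_comod C) :=
  @Colin A C (coring_comod C) (coring_comod C) (lact a : C -> C) lact_colinP.
End LactColin.
End Cofree.

(** * The entwining map of a bicomodule *)

Section Entwining.
Variables (A B : pzRingType) (C : coring A) (D : coring B) (M : bicomod A D).

Lemma bicomod_entwE c x :
  bicomod_entw C M (pure c x) = lact (eps C c : A) (bcoact M x).
Proof. by rewrite /= !tmapE lunitE. Qed.

(** As m(c (x) x) = eps(c) x_0 (x) x_1, left linearity pulls eps(c) out and leaves the counit law of
    [M]. *)
Lemma bicomod_entw_counit : entw_counit (bicomod_entw C M).
Proof.
have [_ counM] := bcoactP M.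
have runit_lact a (u : btens M D) :
    runit M (tmap idfun (eps D) (lact a u)) =
    lact a (runit M (tmap idfun (eps D) u)).
  elim/tens_ind: u => [|u v IHu IHv|x d].
  - by rewrite lact0 !linear0 lact0.
  - by rewrite lactDr !linearD IHu IHv lactDr.
  - by rewrite [lact a _]tens_lactE !tmapE !runitE lactZ.
rewrite /entw_counit.
apply: (tens_ext (f := runit M \o tmap idfun (eps D) \o bicomod_entw C M)
          (g := lunit M \o tmap (eps C) (bid M))) => c x.
rewrite -[LHS]/(runit M (tmap idfun (eps D) (bicomod_entw C M (pure c x)))).
rewrite bicomod_entwE runit_lact /= tmapE lunitE; congr (lact _ _); exact: counM.
Qed.

(** The scalar eps(c_2) moves across the tensor over A, and c_1 eps(c_2) = c. *)
Lemma assocV_entw_Delta c x :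
  assocV C M D (tmap idfun (bicomod_entw C M)
    (assoc C C M (pure (Delta C c) x))) = assocV C M D (pure c (bcoact M x)).
Proof.
(* Now both sides are additive functions of Delta(c), so induction on that tensor applies. *)
rewrite -[c in RHS](cor_counitr c) /=.
elim/tens_ind: (Delta C c) => [|t u IHt IHu|c1 c2].
- by rewrite !(linear0, pure0l).
- by rewrite !(linearD, pureDl) IHt IHu.
- by rewrite assocE !tmapE bicomod_entwE runitE pure_bal.
Qed.

(** Once [assocV_entw_Delta] removes one copy of m, both sides are eps(c) times the two sides of the
    coassociativity of [M] at x. *)
Lemma bicomod_entw_comult : entw_comult (bicomod_entw C M).
Proof.
have [coM _] := bcoactP M.
have entwV c (u : btens M D) :
    assoc M D D (tmap (bicomod_entw C M) (bid D) (assocV C M D (pure c u))) =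
    lact (eps C c : A)
      (assoc M D D (tmap (bcoact M) (bid D) u) : btens M (btens D D)).
  have assoc_lact a (v : btens M D) d :
      assoc M D D (pure (lact a v) d) =
      lact a (assoc M D D (pure v d) : btens M (btens D D)).
    elim/tens_ind: v => [|v w IHv IHw|x d'].
    - by rewrite lact0 pure0l linear0 lact0.
    - by rewrite lactDr !pureDl !linearD IHv IHw lactDr.
    - by rewrite [lact a _]tens_lactE !assocE [RHS]tens_lactE.
  elim/tens_ind: u => [|u v IHu IHv|x d].
  - by rewrite pure0r !linear0 lact0.
  - by rewrite pureDr !linearD lactDr IHu IHv.
  - by rewrite assocVE !tmapE bicomod_entwE assoc_lact.
apply: (tens_ext (f := assoc M D D \o tmap (bicomod_entw C M) (bid D) \o
                       assocV C M D \o tmap idfun (bicomod_entw C M) \o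
                       assoc C C M \o tmap (Delta C) (bid M))
          (g := tmap idfun (Delta D) \o bicomod_entw C M)) => c x.
rewrite -[RHS]/(tmap idfun (Delta D) (bicomod_entw C M (pure c x))).
rewrite bicomod_entwE (btmap_lact (bid M) (Delta D)) -[RHS](congr1 _ (coM x)).
rewrite -entwV -assocV_entw_Delta.
by rewrite -[LHS]/(assoc M D D (tmap (bicomod_entw C M) (bid D)
   (assocV C M D (tmap idfun (bicomod_entw C M) (assoc C C M
     (tmap (Delta C) (bid M) (pure c x))))))) tmapE.
Qed.
End Entwining.

(** * Evaluation maps of natural transformations *)

Section Evaluation.
Variables (A B : pzRingType) (C : coring A) (D : coring B).
Variables (M : bicomod A D) (N : bicomod B C).
Variable teta : nattrans (fcomp (fcomp (tens_functor N) (forget D))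
                                (fcomp (tens_functor M) (forget C)))
                         (fid (ComodCat C)).

(** The type ascription unfolds the composite functors, so that a component can be applied to
    elements. *)
Definition ntcol (X : comod C) : colin (tens_comod N (tens X M)) X := teta X.

Lemma ntcol_nat (X Y : comod C) (f : colin X Y) t :
  ntcol Y (tmap (tmap f (bid M)) (bid N) t) = f (ntcol X t).
Proof.
exact/esym/(congr1 (fun g : colin (tens_comod N (tens X M)) Y => g t) (nt_nat teta f)).
Qed.

Definition ntC : {linear btens (btens C M) N -> C} := ntcol (coring_comod C).

(** A component is a priori only right linear; left linearity is naturality along [lact_colin]. *)
Lemma ntC_lact a (t : btens (btens C M) N) : ntC (lact a t) = lact a (ntC t).
Proof.
rewrite -[RHS](ntcol_nat (lact_colin C a)); congr (ntcol (coring_comod C) _).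
elim/tens_ind: t => [|t u IHt IHu|t n].
- by rewrite lact0 linear0.
- by rewrite lactDr linearD IHt IHu.
rewrite [LHS]tens_lactE tmapE; congr pure.
elim/tens_ind: t => [|t u IHt IHu|c m].
- by rewrite lact0 linear0.
- by rewrite lactDr linearD IHt IHu.
- by rewrite [LHS]tens_lactE tmapE.
Qed.

Definition evalC : bihom (btens (btens C M) N) (regbimod A) :=
  bcomp (eps C) (Bihom ntC_lact).

Lemma ntcol_eval (X : comod C) (x : X) m n :
  ntcol X (pure (pure x m) n) =
  runit X (tmap idfun evalC (assoc X (btens C M) N
    (pure (assoc X C M (pure (coact X x) m)) n))).
Proof.
have [_ counX] := coactP X; rewrite -[LHS]counX /=.
(* Naturality along the coaction passes to the cofree comodule, where x is replaced by x_0 (x)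
   x_1. *)
rewrite -[coact X (ntcol X _)](ntcol_nat (coact_colin X)) !tmapE /=.
elim/tens_ind: (coact X x) => [|t u IHt IHu|y c].
- by rewrite !(linear0, pure0l).
- by rewrite !(linearD, pureDl) IHt IHu.
rewrite !assocE tmapE; have := ntcol_nat (pure_colin C y) (pure (pure c m) n).
by rewrite !tmapE /= => ->; rewrite tmapE.
Qed.

(** Both sides send c (x) m (x) n to eta~_C(c (x) m (x) n). *)
Lemma eval_comult_evalC :
  eval_comult (bicomod_entw C M) (bicomod_entw D N) evalC.
Proof.
(* The scalar eps_D(d) produced by the second entwining moves onto the factor in [M], where the
   counit law of [M] will absorb it. *)
have step c (u : btens M D) n :
    assocV (btens C M) N C (tmap idfun (bicomod_entw D N) (assoc (btens C M) D N
      (pure (assocV C M D (pure c u)) n))) =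
    assocV (btens C M) N C (pure (pure c (runit M (tmap idfun (eps D) u)) : btens C M)
      (bcoact N n)).
  elim/tens_ind: u => [|u v IHu IHv|m d].
  - by rewrite !(linear0, pure0l, pure0r).
  - by rewrite pureDr linearD pureDl !linearD IHu IHv pureDr pureDl linearD.
  - by rewrite assocVE assocE !tmapE bicomod_entwE runitE pureZ pure_bal.
apply: (tens_ext
  (f := lunit C \o tmap evalC (bid C) \o assocV (btens C M) N C \o
        tmap idfun (bicomod_entw D N) \o assoc (btens C M) D N \o
        tmap (assocV C M D) (bid N) \o
        tmap (tmap idfun (bicomod_entw C M)) (bid N) \o
        tmap (assoc C C M) (bid N) \o tmap (tmap (Delta C) (bid M)) (bid N))
  (g := runit C \o tmap idfun evalC \o assoc C (btens C M) N \o
        tmap (assoc C C M) (bid N) \o tmap (tmap (Delta C) (bid M)) (bid N))) => t n.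
elim/tens_ind: t => [|t u IHt IHu|c m].
- by rewrite pure0l [LHS]linear0 [RHS]linear0.
- by rewrite pureDl [LHS]linearD [RHS]linearD; congr (_ + _).
rewrite /= !tmapE /= assocV_entw_Delta step.
have [_ /(_ m) /= ->] := bcoactP M.
rewrite -[RHS](ntcol_eval (X := coring_comod C)).
(* Inserting (eps (x) C) Delta brings in Delta after eta~_C, which colinearity turns into the
   coaction of [N] on n. *)
rewrite -[RHS]cor_counitl /=.
rewrite [Delta C _](colinP (ntcol (coring_comod C)) (pure (pure c m) n)) /= tmapE /=.
elim/tens_ind: (assocV _ _ _ _) => [|t u IHt IHu|t c'].
- by rewrite !linear0.
- by rewrite !linearD IHt IHu.
- by rewrite !tmapE.
Qed.
End Evaluation.

Lemma eval_entw_evalC (A B : pzRingType) (C : coring A) (D : coring B)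
    (M : bicomod A D) (N : bicomod B C)
    (teta : nattrans (fcomp (fcomp (tens_functor N) (forget D))
                            (fcomp (tens_functor M) (forget C)))
                     (fid (ComodCat C)))
    (trho : nattrans (fcomp (fcomp (tens_functor M) (forget C))
                            (fcomp (tens_functor N) (forget D)))
                     (fid (ComodCat D))) :
  (forall X : comod C,
     ntcol trho (tens_comod M X) =1 tmap (ntcol teta X) (bid M)) ->
  eval_entw (bicomod_entw C M) (evalC teta) (evalC trho).
Proof.
move=> trhoM.
apply: (tens_ext
  (f := lunit M \o tmap (evalC teta) (bid M))
  (g := runit M \o tmap idfun (evalC trho) \o assoc M (btens D N) M \o
    tmap (assoc M D N) (bid M) \o
    tmap (tmap (bicomod_entw C M) (bid N)) (bid M))) => t m'.
elim/tens_ind: t => [|t u IHt IHu|t n].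
- by rewrite pure0l [LHS]linear0 [RHS]linear0.
- by rewrite pureDl [LHS]linearD [RHS]linearD; congr (_ + _).
elim/tens_ind: t => [|t u IHt IHu|c m].
- by rewrite !pure0l [LHS]linear0 [RHS]linear0.
- by rewrite !pureDl [LHS]linearD [RHS]linearD; congr (_ + _).
rewrite /= !tmapE /= !tmapE !lunitE /=.
(* [ntcol_eval] at the comodule C (x) M expands the left side as c (x) m_0 rho(m_1 (x) n (x) m');
   applying eps_C (x) M turns the right side into eta(c (x) m (x) n) m'. *)
have := trhoM (coring_comod C) (pure (pure (pure c m) n) m').
rewrite ntcol_eval tmapE /= => /(congr1 (lunit M \o tmap (eps C) (bid M))) /=.
rewrite !tmapE lunitE /= => <-.
elim/tens_ind: (bcoact M m) => [|t u IHt IHu|x d].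
- by rewrite lact0 !(linear0, pure0l, pure0r).
- by rewrite lactDr !(linearD, pureDl, pureDr) IHt IHu.
- rewrite [lact _ _]tens_lactE assocVE !assocE !tmapE !runitE.
  by rewrite !linearZ tmapE lunitE.
Qed.

Theorem proposition2p5 (A B : pzRingType) (C : coring A) (D : coring B)
  (FM : functor (ComodCat C) (ComodCat D)) (FN : functor (ComodCat D) (ComodCat C))
  (FM_add : additive_functor FM) (FN_add : additive_functor FN)
  (FM_coker : preserves_cokernels FM) (FN_coker : preserves_cokernels FN)
  (FM_sum : preserves_direct_sums FM) (FN_sum : preserves_direct_sums FN)
  (teta : nattrans (fcomp FN FM) (fid (ComodCat C)))
  (trho : nattrans (fcomp FM FN) (fid (ComodCat D)))
  (teta_FN : forall Y : ComodCat D, teta (FN Y) = fmap FN (trho Y))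
  (trho_FM : forall X : ComodCat C, trho (FM X) = fmap FM (teta X))
  (M : bicomod A D) (N : bicomod B C)
  (eFM : FM = fcomp (tens_functor M) (forget C))
  (eFN : FN = fcomp (tens_functor N) (forget D)) :
  let teta_C : colin _ (coring_comod C) :=
    nat_transport eFM eFN teta (coring_comod C) in
  let trho_D : colin _ (coring_comod D) :=
    nat_transport eFN eFM trho (coring_comod D) in
  exists (eta : bihom (btens (btens C M) N) (regbimod A))
         (rho : bihom (btens (btens D N) M) (regbimod B)),
    [/\ forall t, eta t = eps C (teta_C t),
        forall t, rho t = eps D (trho_D t) &
        is_one_cell (bicomod_entw C M) (bicomod_entw D N) eta rho].
Proof.
(* After substitution the transports compute to the identity, so both formulas for eta and rho hold
   by conversion. *)
subst FM FN => /=; exists (evalC teta), (evalC trho); split=> //.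
split; [exact: bicomod_entw_counit|exact: bicomod_entw_comult
       |exact: bicomod_entw_counit|exact: bicomod_entw_comult
       |exact: eval_comult_evalC|exact: eval_comult_evalC| |].
- apply: eval_entw_evalC => X t.
  exact: (congr1 (fun g : colin (tens_comod M (tens (tens X M) N)) (tens_comod M X) => g t)
           (trho_FM X)).
- apply: eval_entw_evalC => Y t.
  exact: (congr1 (fun g : colin (tens_comod N (tens (tens Y N) M)) (tens_comod N Y) => g t)
           (teta_FN Y)).
Qed.
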